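(* Let $\alpha\in(0,1)$ and let $a=x_0<x_1<\cdots<x_N=b$ be an arbitrary (possibly nonuniform) grid. If the SOE tolerance $\epsilon$ is sufficiently small, then the fast collocation scheme is uniquely solvable. That is, there exists $\epsilon_0>0$ (depending on $\alpha$ and on the grid) such that for every $0<\epsilon\le\epsilon_0$, every SOE approximation $\{(\lambda_s,\theta_s)\}_{s=1}^{N_e}$ with tolerance $\epsilon$, and every choice of right-hand sides $f_1,\dots,f_{N-1}\in\mathbb{R}$, there is exactly one vector $(U_0,U_1,\dots,U_N)$ with $U_0=U_N=0$ and $$\mathcal{L}_h[U]_i=f_i,\qquad i=1,2,\dots,N-1 .$$
   Context: Grid: $h_j=x_j-x_{j-1}$ for $1\le j\le N$. $\phi_j$ ($1\le j\le N-1$) is the continuous piecewise linear nodal (hat) basis function with $\phi_j(x_k)=\delta_{jk}$, equal to zero outside $[x_{j-1},x_{j+1}]$. For $v=(v_0,\dots,v_N)$ with $v_0=v_N=0$, put $\Pi_h v(y)=\sum_{j=1}^{N-1}v_j\phi_j(y)$ for $y\in\mathbb{R}$ (so it vanishes outside $(a,b)$). Constant: $C_\alpha=\dfrac{\alpha 2^{\alpha-1}\Gamma(\frac{1+\alpha}{2})}{\pi^{1/2}\Gamma(1-\frac{\alpha}{2})}>0$. SOE (sum-of-exponentials) approximation with tolerance $\epsilon$: a positive integer $N_e$ and positive numbers $\lambda_s,\theta_s$ ($1\le s\le N_e$) such that $$\Big|x^{-1-\alpha}-\sum_{s=1}^{N_e}\theta_s e^{-\lambda_s x}\Big|\le\epsilon\quad\text{for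 all }x\in[\Delta x,X],$$ where $0<\Delta x\le\min_j h_j$ and $X\ge b-a$. (Such approximations exist for every $\epsilon>0$.) Fast collocation operator for $\alpha\in(0,1)$ and $1\le i\le N-1$: $$\mathcal{L}_h[v]_i=C_\alpha\Big\{-\frac{1}{1-\alpha}\Big(h_i^{-\alpha}v_{i-1}-\frac{h_i^{-\alpha}+h_{i+1}^{-\alpha}}{\alpha}v_i+h_{i+1}^{-\alpha}v_{i+1}\Big)-\sum_{s=1}^{N_e}\theta_s\mathcal{S}^L_{i,s}[v]-\sum_{s=1}^{N_e}\theta_s\mathcal{S}^R_{i,s}[v]\Big\},$$ $$\mathcal{S}^L_{i,s}[v]=\int_{-\infty}^{x_{i-1}}e^{-\lambda_s(x_i-y)}\Pi_hv(y)\,dy,\qquad \mathcal{S}^R_{i,s}[v]=\int_{x_{i+1}}^{+\infty}e^{-\lambda_s(y-x_i)}\Pi_hv(y)\,dy .$$ *)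

(* Defs.v *)
From HB Require Import structures.
From mathcomp Require Import all_boot all_order all_algebra.
From mathcomp Require Import all_classical all_reals all_analysis.

Set Implicit Arguments.
Unset Strict Implicit.
Unset Printing Implicit Defensive.

Import Order.TTheory GRing.Theory Num.Theory.
Import numFieldNormedType.Exports.
Local Open Scope classical_set_scope.
Local Open Scope ring_scope.

(* Euler's integral; only meaningful for [0 < z]. *)
Definition Gamma (R : realType) (z : R) : R :=
  (\int[lebesgue_measure]_(t in `]0, +oo[) (t `^ (z - 1) * expR (- t)))%R.

Definition Calpha (R : realType) (alpha : R) : R :=
  alpha * 2 `^ (alpha - 1) * Gamma ((1 + alpha) / 2)
  / (pi `^ (1 / 2) * Gamma (1 - alpha / 2)).

(* Vectors (w_0, ..., w_N) are rows of length N.+1; [ent w j] is w_j, and is to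
   be read only for j <= N ([inord] sends larger j to 0). *)
Definition ent (R : realType) (N : nat) (w : 'rV[R]_N.+1) (j : nat) : R :=
  w ord0 (inord j).

Definition is_grid (R : realType) (N : nat) (a b : R) (x : 'rV[R]_N.+1) : Prop :=
  [/\ ent x 0 = a, ent x N = b &
      forall j : nat, (j < N)%N -> ent x j < ent x j.+1].

(* h_j = x_j - x_(j-1), for 1 <= j <= N. *)
Definition step (R : realType) (N : nat) (x : 'rV[R]_N.+1) (j : nat) : R :=
  ent x j - ent x j.-1.

(* phi_j, for 1 <= j <= N - 1. *)
Definition hat (R : realType) (N : nat) (x : 'rV[R]_N.+1) (j : nat) (y : R) : R :=
  if ent x j.-1 <= y <= ent x j then (y - ent x j.-1) / step x j
  else if ent x j <= y <= ent x j.+1 then (ent x j.+1 - y) / step x j.+1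
  else 0.

Definition interp (R : realType) (N : nat) (x v : 'rV[R]_N.+1) (y : R) : R :=
  \sum_(1 <= j < N) ent v j * hat x j y.

(* The SOE on [[Dx, X]]; the terms are indexed by 0, ..., Ne - 1 rather than
   by 1, ..., Ne. *)
Definition is_SOE (R : realType) (alpha eps Dx X : R)
    (Ne : nat) (lam theta : 'I_Ne -> R) : Prop :=
  [/\ (0 < Ne)%N,
      forall s : 'I_Ne, 0 < lam s,
      forall s : 'I_Ne, 0 < theta s &
      forall y : R, Dx <= y <= X ->
        `| y `^ (- 1 - alpha) - \sum_(s < Ne) theta s * expR (- lam s * y) |
          <= eps].

Definition SL (R : realType) (N : nat) (x : 'rV[R]_N.+1) (lam : R) (i : nat)
    (v : 'rV[R]_N.+1) : R :=
  (\int[lebesgue_measure]_(y in `]-oo, ent x i.-1])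
     (expR (- lam * (ent x i - y)) * interp x v y))%R.

Definition SR (R : realType) (N : nat) (x : 'rV[R]_N.+1) (lam : R) (i : nat)
    (v : 'rV[R]_N.+1) : R :=
  (\int[lebesgue_measure]_(y in `[ent x i.+1, +oo[)
     (expR (- lam * (y - ent x i)) * interp x v y))%R.

(* L_h[v]_i, for 1 <= i <= N - 1. *)
Definition Lh (R : realType) (N : nat) (alpha : R) (x : 'rV[R]_N.+1)
    (Ne : nat) (lam theta : 'I_Ne -> R) (v : 'rV[R]_N.+1) (i : nat) : R :=
  Calpha alpha *
  ( - (1 / (1 - alpha)) *
      ( step x i `^ (- alpha) * ent v i.-1
        - (step x i `^ (- alpha) + step x i.+1 `^ (- alpha)) / alpha * ent v i
        + step x i.+1 `^ (- alpha) * ent v i.+1 )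
    - \sum_(s < Ne) theta s * SL x (lam s) i v
    - \sum_(s < Ne) theta s * SR x (lam s) i v ).

(* Main.v *)
Require Import Defs.
From HB Require Import structures.
From mathcomp Require Import all_boot all_order all_algebra.
From mathcomp Require Import all_classical all_reals all_analysis.
From mathcomp Require Import measurable_realfun.
From mathcomp Require Import ring lra.

Set Implicit Arguments.
Unset Strict Implicit.
Unset Printing Implicit Defensive.

Import Order.TTheory GRing.Theory Num.Theory.
Import numFieldNormedType.Exports.
Local Open Scope classical_set_scope.
Local Open Scope ring_scope.

(** The collocation matrix is strictly diagonally dominant, row by row, once the
    tolerance is small; a strictly diagonally dominant matrix is invertible.

    In row [i] the diagonal coefficient, divided by [Calpha], is
    [(h_i^-alpha + h_(i+1)^-alpha) / (alpha (1 - alpha))], and since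
    [1 / (alpha (1 - alpha)) = 1 / (1 - alpha) + 1 / alpha] it splits into two
    budgets.  The part with [1 / (1 - alpha)] pays exactly for the two
    neighbouring entries of the local term.  The part with [1 / alpha] has to
    pay for the history terms.  The sum of exponentials is positive, and where
    it is integrated it is at most [|x_i - y|^(-1 - alpha) + eps]; the hat
    functions are nonnegative with sum at most [1].  So on vectors bounded by
    [1] the left history costs at most
      [(h_i^-alpha - (x_i - a)^-alpha) / alpha + eps (x_(i-1) - a)],
    and symmetrically on the right ([SL_bound], [SR_bound]).  What is left over,
      [((x_i - a)^-alpha + (b - x_i)^-alpha) / alpha - eps (b - a)]
    or more, is positive as soon as [eps <= (b - a)^(-1 - alpha) / alpha],
    because each of the two powers is at least [(b - a)^-alpha].

    The argument is run as a maximum principle ([Lh_injective]): a solution of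
    the homogeneous problem is inspected at an index where its modulus is
    largest, so the entries of the matrix are never computed.  Existence then
    follows from uniqueness by finite dimension, after the two boundary
    conditions have been added as rows.

    Two facts of analysis are needed besides.  [Calpha] must not vanish, hence
    Euler's integral must be finite and positive at arguments in [(0, 1]]
    ([Gamma_gt0]).  And the scheme is linear in the vector, which requires the
    integrands of the history terms to be integrable: this comes from the
    continuity of the interpolant, obtained by writing each hat function as a
    difference of two clamped ramps ([hatE]). *)

(** * Integrals over segments *)

Lemma Rintegral_segment_derive (R : realType) (f F : R -> R) (u v : R) :
  u <= v ->
  (forall y, y \in `[u, v] -> is_derive y 1 F (f y)) ->
  {within `[u, v], continuous f} ->
  \int[lebesgue_measure]_(y in `[u, v]) f y = F v - F u.
Proof.
move=> + dF cf; rewrite le_eqVlt => /predU1P[<-|uv].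
  by rewrite set_itv1 Rintegral_set1 subrr.
have cF : {within `[u, v], continuous F}.
  by apply: derivable_within_continuous => y /dF [].
rewrite /Rintegral (@continuous_FTC2 _ f F)//.
- have /(continuous_within_itvP _ uv)[_ Fu Fv] := cF.
  split=> // y yuv.
  by have [] := dF y (subset_itv_oo_cc yuv).
- move=> y yuv; rewrite derive1E.
  by have [_] := dF y (subset_itv_oo_cc yuv).
Qed.

Lemma integrable_segment (R : realType) (f : R -> R) (u v : R) :
  {within `[u, v], continuous f} ->
  (@lebesgue_measure R).-integrable `[u, v] (EFin \o f).
Proof.
by move=> cf; apply: continuous_compact_integrable => //; exact: segment_compact.
Qed.

(** * Positivity of the Gamma function and of the constant *)

(** The right-hand side is a constant times the derivative of the bounded
    function [t |-> - expR (- t `^ z)].  This single antiderivative controls the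
    integrand both at [0] and at infinity; the comparison amounts to
    [t `^ z <= 1 + t], true because [z <= 1]. *)
Lemma le_powR_minus1_expR (R : realType) (z t : R) : 0 < z <= 1 -> 0 < t ->
  t `^ (z - 1) * expR (- t) <=
  expR 1 / z * (z * t `^ (z - 1) * expR (- t `^ z)).
Proof.
move=> /andP[z0 z1] t0.
have tz : t `^ z <= 1 + t.
  have [t1|t1] := leP t 1.
    have : t `^ z <= 1 `^ z by rewrite ge0_ler_powR ?nnegrE// ltW.
    by rewrite powR1 => /le_trans; apply; rewrite lerDl ltW.
  by rewrite (le_trans (ler1_powR (ltW t1) z1))// lerDr.
rewrite [leRHS](_ : _ = t `^ (z - 1) * expR (1 - t `^ z)).
  by rewrite ler_wpM2l ?powR_ge0// ler_expR; lra.
by rewrite expRD; field; rewrite gt_eqF.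
Qed.

Lemma continuous_Gamma_integrand (R : realType) (z u v : R) : 0 < u ->
  {within `[u, v], continuous (fun t : R => t `^ (z - 1) * expR (- t))}.
Proof.
move=> u0; apply: derivable_within_continuous => t; rewrite in_itv/= => /andP[ut _].
have t0 := lt_le_trans u0 ut.
apply: derivableM; first by apply: derivable_powR; rewrite in_itv/= t0.
exact: ex_derive.
Qed.

(** The bound does not depend on the segment, which makes the improper integral
    finite. *)
Lemma Gamma_integrand_segment_le (R : realType) (z u v : R) :
  0 < z <= 1 -> 0 < u <= v ->
  \int[lebesgue_measure]_(t in `[u, v]) (t `^ (z - 1) * expR (- t))
    <= expR 1 / z.
Proof.
move=> z01 /andP[u0 uv]; have /andP[z0 z1] := z01.
pose g (t : R) : R := z * t `^ (z - 1) * expR (- t `^ z).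
have pos t : t \in `[u, v] -> 0 < t.
  by rewrite in_itv/= => /andP[/(lt_le_trans u0)].
have dF t : t \in `[u, v] -> is_derive t 1 (fun t => - expR (- t `^ z)) (g t).
  move=> /pos t0.
  have d1 := is_derive1_powR z t0.
  apply: is_derive_eq.
  by rewrite /g mulrN opprK mulrC.
have cg : {within `[u, v], continuous g}.
  apply: derivable_within_continuous => t /pos t0.
  have d1 := is_derive1_powR z t0.
  have d2 := is_derive1_powR (z - 1) t0.
  exact: ex_derive.
have cg' : {within `[u, v], continuous (fun t => expR 1 / z * g t)}.
  move=> t; apply: cvgM; [exact: cvg_cst|exact: cg].
apply: (@le_trans _ _ (\int[lebesgue_measure]_(t in `[u, v]) (expR 1 / z * g t))).
  apply: le_Rintegral => //.
  - by apply: integrable_segment; exact: continuous_Gamma_integrand.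
  - exact: integrable_segment.
  - by move=> t /= /pos t0; exact: le_powR_minus1_expR.
rewrite RintegralZl//; last exact: integrable_segment.
rewrite (Rintegral_segment_derive uv dF cg) ler_piMr//.
  by rewrite divr_ge0 ?expR_ge0 ?ltW.
rewrite opprK addrC.
have : expR (- u `^ z) <= 1 by rewrite expR_le1 oppr_le0 powR_ge0.
by have := expR_gt0 (- v `^ z); lra.
Qed.

(** A [Rintegral] is [0] when the integral is infinite, so finiteness has to be
    proved first: the half-line is exhausted by the segments [[1/(n+1), n+1]],
    on which the integral is uniformly bounded.  The integral over [[1, 2]] then
    bounds the whole from below. *)
Lemma Gamma_gt0 (R : realType) (z : R) : 0 < z <= 1 -> 0 < Gamma z.
Proof.
move=> z01; have /andP[z0 z1] := z01.
pose g (t : R) : R := t `^ (z - 1) * expR (- t).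
have g0 t : 0 <= g t by rewrite mulr_ge0 ?powR_ge0 ?expR_ge0.
have mg : measurable_fun setT g.
  by apply: measurable_funM; [exact: measurable_powR|apply: measurableT_comp].
pose F (n : nat) : set R := `[n.+1%:R^-1, n.+1%:R]%classic.
have Fle (n : nat) : n.+1%:R^-1 <= n.+1%:R :> R.
  by rewrite (@le_trans _ _ 1)// ?invf_le1 ?ler1n ?ltr0n.
have FU : \bigcup_n F n = `]0, +oo[%classic.
  apply/seteqP; split => [t [n _]|t]; rewrite /F/= !in_itv/= andbT.
    by move=> /andP[+ _]; apply: lt_le_trans; rewrite invr_gt0 ltr0n.
  move=> t0; exists (Num.trunc (t + t^-1)) => //=; rewrite in_itv/=.
  have h : t + t^-1 < (Num.trunc (t + t^-1)).+1%:R by exact: truncnS_gt.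
  have ti : 0 < t^-1 by rewrite invr_gt0.
  apply/andP; split; last by lra.
  rewrite invf_ple ?posrE ?ltr0n//; lra.
have le_int : (\int[lebesgue_measure]_(t in `]0%R, +oo[) (g t)%:E <= (expR 1 / z)%:E)%E.
  rewrite -FU.
  have nF : nondecreasing_seq F.
    move=> m n mn; apply/subsetPset => t; rewrite /F/= !in_itv/= => /andP[tm tM].
    rewrite (le_trans _ tm) ?(le_trans tM)// ?ler_nat//.
    by rewrite lef_pV2 ?posrE ?ltr0n// ler_nat.
  have cv : (\int[lebesgue_measure]_(t in F n) (g t)%:E @[n --> \oo] -->
      \int[lebesgue_measure]_(t in \bigcup_n F n) (g t)%:E)%E.
    apply: (ge0_nondecreasing_set_cvg_integral (mu := @lebesgue_measure R) nF).
    - by move=> n; exact: measurable_itv.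
    - by move=> n; apply/measurable_EFinP; apply: measurable_funTS.
    - by move=> n t _; rewrite lee_fin.
  rewrite -(cvg_lim _ cv)//; apply: lime_le; first exact/cvgP/cv.
  apply: nearW => n.
  have n0 : 0 < n.+1%:R^-1 :> R by rewrite invr_gt0 ltr0n.
  have In : (@lebesgue_measure R).-integrable (F n) (EFin \o g).
    by apply: integrable_segment; exact: continuous_Gamma_integrand.
  rewrite -(fineK (integrable_fin_num _ In))//; last exact: measurable_itv.
  rewrite lee_fin.
  by apply: Gamma_integrand_segment_le; rewrite ?n0 ?Fle.
have Ig : (@lebesgue_measure R).-integrable `]0, +oo[ (EFin \o g).
  apply/integrableP; split; first by apply/measurable_EFinP; apply: measurable_funTS.
  apply: (@le_lt_trans _ _ (expR 1 / z)%:E); last exact: ltry.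
  apply: le_trans le_int; apply: ge0_le_integral => //=.
  - by apply/measurable_EFinP/measurableT_comp => //; apply: measurable_funTS.
  - by apply/measurable_EFinP; apply: measurable_funTS.
  - by move=> t _; rewrite lee_fin ger0_norm.
have sub : `[1, 2] `<=` (`]0, +oo[ : set R).
  by move=> t /=; rewrite !in_itv/= andbT => /andP[]; lra.
have I12 : (@lebesgue_measure R).-integrable `[1, 2] (EFin \o g).
  by apply: integrable_segment; exact: continuous_Gamma_integrand.
apply: (@lt_le_trans _ _ (\int[lebesgue_measure]_(t in `[1, 2]) (expR (- 2) / 2 : R))).
  rewrite Rintegral_cst//= lebesgue_measure_itv/= lte_fin ltr1n /=.
  by rewrite mulr_gt0// ?divr_gt0 ?expR_gt0//; lra.
apply: (@le_trans _ _ (\int[lebesgue_measure]_(t in `[1, 2]) g t)).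
  apply: le_Rintegral => //.
    by apply: integrable_segment; apply: continuous_subspaceT => t; exact: cvg_cst.
  move=> t /=; rewrite in_itv/= => /andP[t1 t2].
  have t0 : 0 < t by lra.
  rewrite /g mulrC ler_pM ?expR_ge0 ?invr_ge0 ?ler_expR//; last by lra.
  have : t `^ (- 1) <= t `^ (z - 1) by rewrite ler_powR//; lra.
  rewrite powR_inv1 ?(ltW t0)// => /(le_trans _); apply.
  by rewrite lef_pV2 ?posrE//.
rewrite /Gamma -/g.
rewrite /Rintegral fine_le ?integrable_fin_num//.
apply: ge0_subset_integral => //.
- by apply/measurable_EFinP; apply: measurable_funTS.
- by move=> t _; rewrite lee_fin.
Qed.

Lemma Calpha_gt0 (R : realType) (alpha : R) : 0 < alpha < 1 -> 0 < Calpha alpha.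
Proof.
move=> /andP[a0 a1].
rewrite /Calpha divr_gt0 ?mulr_gt0 ?powR_gt0 ?pi_gt0 ?Gamma_gt0//; lra.
Qed.

(** * The hat functions of a grid *)

Section grid.
Variables (R : realType) (N : nat) (a b : R) (x : 'rV[R]_N.+1).
Hypothesis hx : is_grid a b x.

Lemma grid_le (i j : nat) : (i <= j <= N)%N -> ent x i <= ent x j.
Proof.
have [_ _ xlt] := hx.
elim: j => [|j IH]; first by rewrite leqn0 => /andP[/eqP->].
rewrite leq_eqVlt andb_orl => /orP[/andP[/eqP->]//|/andP[ij jN]].
by rewrite (le_trans (IH _)) ?(ltW (xlt _ _))// -ltnS ij/= ltnW.
Qed.

Lemma grid_bounds (j : nat) : (j <= N)%N -> a <= ent x j <= b.
Proof.
have [<- <- _] := hx => jN; by rewrite !grid_le ?jN ?leqnn.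
Qed.

Lemma step_gt0 (j : nat) : (0 < j <= N)%N -> 0 < step x j.
Proof.
have [_ _ xlt] := hx.
by case: j => // j jN; rewrite subr_gt0 xlt.
Qed.

(** The continuous function rising from [0] to [1] across the [j]-th cell.  Hat
    functions are differences of consecutive ramps; this gives their continuity
    without gluing pieces, and makes their sum telescope. *)
Definition ramp (j : nat) (y : R) : R :=
  Num.max 0 (Num.min 1 ((y - ent x j.-1) / step x j)).

Lemma ramp_itv01 (j : nat) (y : R) : 0 <= ramp j y <= 1.
Proof. by rewrite /ramp le_max lexx/= ge_max ler01/= ge_min lexx. Qed.

Lemma ramp_eq0 (j : nat) (y : R) : (0 < j <= N)%N -> y <= ent x j.-1 -> ramp j y = 0.
Proof.
move=> /step_gt0 h0 yx; rewrite /ramp max_l// ge_min.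
by rewrite pmulr_lle0 ?invr_gt0// subr_le0 yx orbT.
Qed.

Lemma ramp_eq1 (j : nat) (y : R) : (0 < j <= N)%N -> ent x j <= y -> ramp j y = 1.
Proof.
move=> /step_gt0 h0 yx; rewrite /ramp min_l ?max_r ?ler01//.
by rewrite ler_pdivlMr// mul1r /step lerD2r.
Qed.

Lemma ramp_affine (j : nat) (y : R) : (0 < j <= N)%N ->
  ent x j.-1 <= y <= ent x j -> ramp j y = (y - ent x j.-1) / step x j.
Proof.
move=> /step_gt0 h0 /andP[py yq]; rewrite /ramp min_r ?max_r//.
  by rewrite divr_ge0 ?(ltW h0) ?subr_ge0.
by rewrite ler_pdivrMr// mul1r /step lerD2r.
Qed.

Lemma continuous_ramp (j : nat) : continuous (ramp j).
Proof.
apply: max_fun_continuous; first by move=> y; exact: cvg_cst.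
apply: min_fun_continuous; first by move=> y; exact: cvg_cst.
move=> y; apply: cvgM; last exact: cvg_cst.
by apply: cvgB; [exact: cvg_id|exact: cvg_cst].
Qed.

Lemma hatE (j : nat) (y : R) : (0 < j < N)%N -> hat x j y = ramp j y - ramp j.+1 y.
Proof.
move=> /andP[j0 jN]; have jN1 := ltnW jN.
have hj : 0 < step x j by rewrite step_gt0 ?j0.
have pq : ent x j.-1 < ent x j by move: hj; rewrite subr_gt0.
have qr : ent x j < ent x j.+1 by case: hx => _ _; apply.
rewrite /hat; case: ifPn => [yj|].
  rewrite ramp_affine ?j0//= ramp_eq0 ?subr0//=.
  by case/andP: yj.
rewrite negb_and -!ltNge => yj.
case: ifPn => [yj1|].
  rewrite ramp_eq1 ?j0//; last by case/andP: yj1.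
  rewrite ramp_affine//=.
  have := @step_gt0 j.+1 jN; rewrite /step/= => h.
  by field; lra.
rewrite negb_and -!ltNge => yj1.
have [yp|py] := ltP y (ent x j.-1).
  by rewrite !ramp_eq0 ?subrr ?j0//=; lra.
have qy : ent x j < y by case/orP: yj; lra.
have ry : ent x j.+1 < y by case/orP: yj1; lra.
by rewrite !ramp_eq1 ?subrr ?j0//; lra.
Qed.

Lemma hat_ge0 (j : nat) (y : R) : (0 < j < N)%N -> 0 <= hat x j y.
Proof.
move=> /andP[j0 jN]; have h1 := @step_gt0 j.+1 jN.
have h0 : 0 < step x j by rewrite step_gt0 ?j0 ?(ltnW jN).
rewrite /hat; case: ifP => [/andP[p _]|_].
  by rewrite divr_ge0 ?(ltW h0) ?subr_ge0.
by case: ifP => [/andP[_ p]|//]; rewrite divr_ge0 ?(ltW h1) ?subr_ge0.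
Qed.

(** The sum telescopes to [ramp 1 y - ramp N y]. *)
Lemma sum_hat_le1 (y : R) : \sum_(1 <= j < N) hat x j y <= 1.
Proof.
have [N1|N1] := leqP N 1; first by rewrite big_geq.
rewrite (eq_big_nat _ _ (F2 := fun j => ramp j y - ramp j.+1 y)); last first.
  by move=> j hj; rewrite hatE.
have /andP[_ r1] := ramp_itv01 1 y; have /andP[rN _] := ramp_itv01 N y.
have -> : \sum_(1 <= j < N) (ramp j y - ramp j.+1 y) = ramp 1 y - ramp N y.
  rewrite -opprB -(telescope_sumr (ramp^~ y) (ltnW N1)) -sumrN.
  by apply: eq_bigr => j _; rewrite opprB.
lra.
Qed.

Lemma interpE (v : 'rV[R]_N.+1) (y : R) :
  interp x v y = \sum_(1 <= j < N) ent v j * (ramp j y - ramp j.+1 y).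
Proof. by rewrite /interp; apply: eq_big_nat => j /hatE ->. Qed.

Lemma continuous_interp (v : 'rV[R]_N.+1) : continuous (interp x v).
Proof.
rewrite (_ : interp x v = fun y =>
    \sum_(1 <= j < N) ent v j * (ramp j y - ramp j.+1 y)); last first.
  by apply/funext => y; exact: interpE.
apply: continuous_big => [|j _ y]; first exact: add_continuous.
apply: cvgM; first exact: cvg_cst.
by apply: cvgB; exact: continuous_ramp.
Qed.

Lemma interp_outside (v : 'rV[R]_N.+1) (y : R) : ~~ (a <= y <= b) -> interp x v y = 0.
Proof.
move=> yab; rewrite interpE big_nat big1// => j /andP[j0 jN].
have /andP[aj _] := grid_bounds (leq_trans (leq_pred j) (ltnW jN)).
have /andP[aj' jb] := grid_bounds (ltnW jN).
have /andP[_ jb'] := grid_bounds jN.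
move: yab; rewrite negb_and -!ltNge => /orP[ya|yb].
  by rewrite !ramp_eq0 ?subrr ?mulr0 ?j0 ?(ltnW jN)//=; lra.
by rewrite !ramp_eq1 ?subrr ?mulr0 ?j0 ?(ltnW jN)//=; lra.
Qed.

(** The values of the interpolant are sub-convex combinations of the nodal
    values. *)
Lemma interp_bound (v : 'rV[R]_N.+1) (M y : R) :
  (forall j : nat, (j <= N)%N -> `|ent v j| <= M) -> `|interp x v y| <= M.
Proof.
move=> vM; have M0 : 0 <= M by apply: le_trans (vM 0 isT).
rewrite (le_trans (ler_norm_sum _ _ _))//.
rewrite (@le_trans _ _ (\sum_(1 <= j < N) M * hat x j y))//.
  apply: ler_sum_nat => j /andP[j0 jN].
  have h0 : 0 <= hat x j y by rewrite hat_ge0 ?j0.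
  by rewrite normrM (ger0_norm h0) ler_wpM2r// vM// ltnW.
by rewrite -mulr_sumr ler_piMr// sum_hat_le1.
Qed.

Lemma interp_linear (y : R) : linear_for *%R (fun v => interp x v y).
Proof.
move=> k u v; rewrite /interp mulr_sumr -big_split/=; apply: eq_bigr => j _.
by rewrite /ent !mxE mulrDl mulrA.
Qed.

End grid.

(** * The power kernel and the exponential sum away from the diagonal *)

Section segment_integrals.
Variable R : realType.
Notation mu := (@lebesgue_measure R).

Lemma Rintegral_support (D E : set R) (f : R -> R) : E `<=` D ->
  (forall y, D y -> ~ E y -> f y = 0) ->
  \int[mu]_(y in D) f y = \int[mu]_(y in E) f y.
Proof.
move=> ED f0; rewrite Rintegral_mkcond [RHS]Rintegral_mkcond.
congr Rintegral; apply/funext => y; rewrite !patchE.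
case: (boolP (y \in E)) => [/set_mem/ED/mem_set ->//|].
move/negP => yE; case: ifPn => // /set_mem Dy.
by apply: f0 => // /mem_set.
Qed.

Lemma Rintegral_sum_segment (I : Type) (r : seq I) (f : I -> R -> R) (u v : R) :
  (forall s, continuous (f s)) ->
  \int[mu]_(y in `[u, v]) (\sum_(s <- r) f s y) =
  \sum_(s <- r) \int[mu]_(y in `[u, v]) f s y.
Proof.
move=> cf; elim: r => [|s r IH].
  rewrite big_nil; under eq_Rintegral do rewrite big_nil.
  by rewrite Rintegral_cst//= mul0r.
rewrite big_cons -IH; under eq_Rintegral do rewrite big_cons.
rewrite RintegralD//; apply: integrable_segment; apply: continuous_subspaceT => //.
by apply: continuous_big => //; exact: add_continuous.
Qed.

Lemma is_derive_powR_dist (sigma c p y : R) : 0 < sigma * (y - c) ->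
  is_derive y 1 (fun y => (sigma * (y - c)) `^ p)
    (sigma * (p * (sigma * (y - c)) `^ (p - 1))).
Proof.
move=> dy; have d1 := @is_derive1_powR R p _ dy.
have d2 : is_derive y 1 (fun y => sigma * (y - c)) sigma.
  by apply: is_derive_eq; rewrite subr0 /GRing.scale/= mulr1.
have := @is_derive1_comp R (@powR R ^~ p) (fun y => sigma * (y - c)) y _ _ d1 d2.
by rewrite mulrC.
Qed.

(** [sigma] is [1] or [-1]: the distance to [c] on the side of [c] that contains
    [[u, v]] is [sigma * (y - c)]. *)
Lemma Rintegral_powR_dist (sigma alpha c u v : R) : sigma * sigma = 1 ->
  0 < alpha -> u <= v ->
  (forall y, y \in `[u, v] -> 0 < sigma * (y - c)) ->
  \int[mu]_(y in `[u, v]) (sigma * (y - c)) `^ (- 1 - alpha) =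
  sigma * ((sigma * (u - c)) `^ (- alpha) - (sigma * (v - c)) `^ (- alpha)) / alpha.
Proof.
move=> ss a0 uv d0.
pose F (y : R) := - (sigma / alpha) * (sigma * (y - c)) `^ (- alpha).
have dF y : y \in `[u, v] -> is_derive y 1 F ((sigma * (y - c)) `^ (- 1 - alpha)).
  move=> yuv; have d1 := is_derive_powR_dist (- alpha) (d0 y yuv).
  apply: is_derive_eq; rewrite /GRing.scale/=.
  rewrite (_ : - 1 - alpha = - alpha - 1); last by ring.
  transitivity (sigma * sigma * (sigma * (y - c)) `^ (- alpha - 1)).
    by field; rewrite gt_eqF.
  by rewrite ss mul1r.
rewrite (Rintegral_segment_derive uv dF).
  by rewrite /F; field; rewrite gt_eqF.
apply: derivable_within_continuous => y /d0.
by move=> /(is_derive_powR_dist (- 1 - alpha)) [].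
Qed.

Lemma continuous_weight (lam sigma c : R) :
  continuous (fun y => expR (- lam * (sigma * (y - c)))).
Proof.
move=> y; apply: continuous_comp; last exact: continuous_expR.
apply: cvgM; first exact: cvg_cst.
apply: cvgM; first exact: cvg_cst.
by apply: cvgB; [exact: cvg_id|exact: cvg_cst].
Qed.

(** The exponential sum [K] is positive and within [eps] of the power kernel
    [(sigma * (y - c)) `^ (- 1 - alpha)] on [[u, v]], whose integral is explicit;
    so the far-field contribution of a function bounded by [M] is at most that
    integral plus [eps * (v - u)], times [M].  Taking [sigma] to be [-1] or [1]
    covers the segments to the left and to the right of [c]. *)
Lemma SOE_tail_bound (alpha eps Dx X : R) (Ne : nat) (lam theta : 'I_Ne -> R)
    (sigma c u v M : R) (w : R -> R) :
  0 < alpha -> 0 < Dx -> is_SOE alpha eps Dx X lam theta ->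
  sigma * sigma = 1 -> u <= v ->
  (forall y, y \in `[u, v] -> Dx <= sigma * (y - c) <= X) ->
  continuous w -> (forall y, `|w y| <= M) ->
  `| \sum_(s < Ne) theta s *
       \int[mu]_(y in `[u, v]) (expR (- lam s * (sigma * (y - c))) * w y) | <=
  M * (sigma * ((sigma * (u - c)) `^ (- alpha)
                - (sigma * (v - c)) `^ (- alpha)) / alpha + eps * (v - u)).
Proof.
move=> a0 Dx0 [_ lam0 theta0 soe] ss uv dDX cw wM.
pose d y := sigma * (y - c).
pose K y := \sum_(s < Ne) theta s * expR (- lam s * d y).
have ce s : continuous (fun y => expR (- lam s * d y)).
  exact: continuous_weight.
have cew s : continuous (fun y => expR (- lam s * d y) * w y).
  by move=> y; apply: cvgM; [exact: ce|exact: cw].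
have cK : continuous K.
  apply: continuous_big => [|s _ y]; first exact: add_continuous.
  by apply: cvgM; [exact: cvg_cst|exact: ce].
have d0 y : y \in `[u, v] -> 0 < d y.
  by move=> /dDX /andP[+ _]; exact: lt_le_trans.
have seg (f : R -> R) : continuous f -> mu.-integrable `[u, v] (EFin \o f).
  by move=> cf; apply: integrable_segment; exact: continuous_subspaceT.
have cp : {within `[u, v], continuous (fun y => d y `^ (- 1 - alpha))}.
  apply: derivable_within_continuous => y /d0.
  by move=> /(is_derive_powR_dist (- 1 - alpha)) [].
have cKw : continuous (fun y => K y * w y).
  by move=> y; apply: cvgM; [exact: cK|exact: cw].
rewrite (_ : \sum_(s < Ne) _ = \int[mu]_(y in `[u, v]) (K y * w y)); last first.
  under [RHS]eq_Rintegral do rewrite mulr_suml.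
  rewrite Rintegral_sum_segment; last first.
    move=> s y; apply: cvgM; last exact: cw.
    by apply: cvgM; [exact: cvg_cst|exact: ce].
  apply: eq_bigr => s _.
  rewrite -RintegralZl//; last exact: seg.
  by apply: eq_Rintegral => y _; rewrite mulrA.
apply: le_trans (le_normr_Rintegral _ _) _ => //; first exact: seg.
have cpe : {within `[u, v], continuous (fun y => M * (d y `^ (- 1 - alpha) + eps))}.
  move=> y; apply: cvgM; first exact: cvg_cst.
  by apply: cvgD; [exact: cp|exact: cvg_cst].
apply: (@le_trans _ _ (\int[mu]_(y in `[u, v]) (M * (d y `^ (- 1 - alpha) + eps)))).
  apply: le_Rintegral => //.
  - by apply: seg => y; apply: cvg_norm; exact: cKw.
  - exact: integrable_segment.
  move=> y /= yuv; rewrite normrM mulrC ler_pM//.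
  have K0 : 0 <= K y.
    by apply: sumr_ge0 => s _; rewrite mulr_ge0 ?expR_ge0// ltW.
  rewrite ger0_norm//.
  have := soe _ (dDX y yuv); rewrite ler_norml => /andP[+ _].
  by rewrite -/(d y) -/(K y); lra.
rewrite RintegralZl//; last first.
  apply: integrable_segment => y.
  by apply: cvgD; [exact: cp|exact: cvg_cst].
rewrite RintegralD//; last 2 first.
- exact: integrable_segment.
- by apply: seg => y; exact: cvg_cst.
rewrite Rintegral_powR_dist// Rintegral_cst//=.
rewrite lebesgue_measure_itv/= lte_fin.
move: uv; rewrite le_eqVlt => /predU1P[->|uv]; first by rewrite ltxx /= (subrr v).
by rewrite uv.
Qed.

End segment_integrals.

(** * The history terms and the maximum principle *)

Section history.
Variables (R : realType) (N : nat) (a b : R) (x : 'rV[R]_N.+1).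
Hypothesis hx : is_grid a b x.
Notation mu := (@lebesgue_measure R).

(** The interpolant vanishes outside [[a, b]], so the half-lines shrink to
    segments; the distance to [x_i] is put in the form [sigma * (y - c)]. *)
Lemma SL_segment (lam : R) (i : nat) (v : 'rV[R]_N.+1) :
  SL x lam i v = \int[mu]_(y in `[a, ent x i.-1])
    (expR (- lam * (-1 * (y - ent x i))) * interp x v y).
Proof.
rewrite /SL (@Rintegral_support _ _ `[a, ent x i.-1]).
- by apply: eq_Rintegral => y _; rewrite mulN1r opprB.
- by move=> y /=; rewrite !in_itv/= => /andP[].
- move=> y /=; rewrite !in_itv/= => yi /negP; rewrite yi andbT => ya.
  by rewrite (interp_outside hx) ?mulr0// (negbTE ya).
Qed.

Lemma SR_segment (lam : R) (i : nat) (v : 'rV[R]_N.+1) :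
  SR x lam i v = \int[mu]_(y in `[ent x i.+1, b])
    (expR (- lam * (1 * (y - ent x i))) * interp x v y).
Proof.
rewrite /SR (@Rintegral_support _ _ `[ent x i.+1, b]).
- by apply: eq_Rintegral => y _; rewrite mul1r.
- by move=> y /=; rewrite !in_itv/= andbT => /andP[].
- move=> y /=; rewrite !in_itv/= andbT => yi /negP; rewrite yi /= => ya.
  by rewrite (interp_outside hx) ?mulr0// (negbTE ya) andbF.
Qed.

Lemma weighted_interp_linear (g : R -> R) (p q k : R) (u w : 'rV[R]_N.+1) :
  continuous g ->
  \int[mu]_(y in `[p, q]) (g y * interp x (k *: u + w) y) =
  k * \int[mu]_(y in `[p, q]) (g y * interp x u y) +
  \int[mu]_(y in `[p, q]) (g y * interp x w y).
Proof.
move=> cg.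
have I t : mu.-integrable `[p, q] (EFin \o (fun y => g y * interp x t y)).
  apply: integrable_segment; apply: continuous_subspaceT => y.
  by apply: cvgM; [exact: cg|exact: (continuous_interp hx)].
have Ik : mu.-integrable `[p, q] (EFin \o (fun y => k * (g y * interp x u y))).
  apply: integrable_segment; apply: continuous_subspaceT => y.
  apply: cvgM; first exact: cvg_cst.
  by apply: cvgM; [exact: cg|exact: (continuous_interp hx)].
rewrite -RintegralZl// -RintegralD//.
by apply: eq_Rintegral => y _; rewrite interp_linear mulrDr mulrCA.
Qed.

Lemma SL_linear (lam : R) (i : nat) (k : R) (u w : 'rV[R]_N.+1) :
  SL x lam i (k *: u + w) = k * SL x lam i u + SL x lam i w.
Proof.
by rewrite !SL_segment weighted_interp_linear//; exact: continuous_weight.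
Qed.

Lemma SR_linear (lam : R) (i : nat) (k : R) (u w : 'rV[R]_N.+1) :
  SR x lam i (k *: u + w) = k * SR x lam i u + SR x lam i w.
Proof.
by rewrite !SR_segment weighted_interp_linear//; exact: continuous_weight.
Qed.

Lemma Lh_linear (alpha : R) (Ne : nat) (lam theta : 'I_Ne -> R) (i : nat)
    (k : R) (u w : 'rV[R]_N.+1) :
  Lh alpha x lam theta (k *: u + w) i =
  k * Lh alpha x lam theta u i + Lh alpha x lam theta w i.
Proof.
have lin (S : R -> nat -> 'rV[R]_N.+1 -> R) :
    (forall l, S l i (k *: u + w) = k * S l i u + S l i w) ->
    \sum_(s < Ne) theta s * S (lam s) i (k *: u + w) =
    k * (\sum_(s < Ne) theta s * S (lam s) i u) +
    \sum_(s < Ne) theta s * S (lam s) i w.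
  move=> Sl; rewrite mulr_sumr -big_split/=; apply: eq_bigr => s _.
  by rewrite Sl; ring.
rewrite /Lh (lin (SL x)); last by move=> l; exact: SL_linear.
rewrite (lin (SR x)); last by move=> l; exact: SR_linear.
by rewrite /ent !mxE; ring.
Qed.

Variables (alpha eps Dx X : R) (Ne : nat) (lam theta : 'I_Ne -> R).
Hypotheses (a0 : 0 < alpha) (Dx0 : 0 < Dx).
Hypothesis DxE : forall j : nat, (1 <= j <= N)%N -> Dx <= step x j.
Hypothesis bX : b - a <= X.
Hypothesis soe : is_SOE alpha eps Dx X lam theta.

Lemma SL_bound (i : nat) (v : 'rV[R]_N.+1) (M : R) : (0 < i < N)%N ->
  (forall j : nat, (j <= N)%N -> `|ent v j| <= M) ->
  `| \sum_(s < Ne) theta s * SL x (lam s) i v | <=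
  M * ((step x i `^ (- alpha) - (ent x i - a) `^ (- alpha)) / alpha
       + eps * (ent x i.-1 - a)).
Proof.
move=> /andP[i0 iN] vM.
under eq_bigr do rewrite SL_segment.
have /andP[ap _] := grid_bounds hx (leq_trans (leq_pred i) (ltnW iN)).
have /andP[ai ib] := grid_bounds hx (ltnW iN).
have hi : Dx <= ent x i - ent x i.-1 by apply: DxE; rewrite i0 ltnW.
apply: le_trans (SOE_tail_bound a0 Dx0 soe _ ap _ _ _) _.
- by ring.
- by move=> y; rewrite in_itv/= => /andP[ay yi]; have := bX; lra.
- exact: (continuous_interp hx).
- by move=> y; apply: (interp_bound hx); exact: vM.
rewrite le_eqVlt; apply/orP; left; apply/eqP.
rewrite !mulN1r !opprB /step; ring.
Qed.

Lemma SR_bound (i : nat) (v : 'rV[R]_N.+1) (M : R) : (0 < i < N)%N ->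
  (forall j : nat, (j <= N)%N -> `|ent v j| <= M) ->
  `| \sum_(s < Ne) theta s * SR x (lam s) i v | <=
  M * ((step x i.+1 `^ (- alpha) - (b - ent x i) `^ (- alpha)) / alpha
       + eps * (b - ent x i.+1)).
Proof.
move=> /andP[i0 iN] vM.
under eq_bigr do rewrite SR_segment.
have /andP[_ qb] := grid_bounds hx iN.
have /andP[ai ib] := grid_bounds hx (ltnW iN).
have hi : Dx <= ent x i.+1 - ent x i by apply: (DxE (j := i.+1)).
apply: le_trans (SOE_tail_bound a0 Dx0 soe _ qb _ _ _) _.
- by ring.
- by move=> y; rewrite in_itv/= => /andP[ay yi]; have := bX; lra.
- exact: (continuous_interp hx).
- by move=> y; apply: (interp_bound hx); exact: vM.
by rewrite !mul1r /step.
Qed.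

Hypothesis a1 : alpha < 1.
Hypothesis eps_ge0 : 0 <= eps.
Hypothesis eps_small : eps <= (b - a) `^ (- 1 - alpha) / alpha.

(** Discrete maximum principle: where [|v_k| = M] is largest, the diagonal term
    would have to be balanced by the other terms, whose bounds leave the
    positive surplus [M * ((DL + DR) / alpha - eps * (b - a))]. *)
Lemma Lh_injective (v : 'rV[R]_N.+1) : ent v 0 = 0 -> ent v N = 0 ->
  (forall i : nat, (1 <= i <= N - 1)%N -> Lh alpha x lam theta v i = 0) ->
  v = 0.
Proof.
move=> v0 vN Lv.
case: (@Order.TotalTheory.arg_maxP _ _ _ (ord0 : 'I_N.+1) xpredT
  (fun j => `|v ord0 j|) isT) => k _ kmax.
have ordv (j : 'I_N.+1) : ent v j = v ord0 j by rewrite /ent inord_val.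
pose M := `|v ord0 k|.
have vM (j : nat) : (j <= N)%N -> `|ent v j| <= M.
  by move=> jN; exact: kmax.
have [vk|vk] := eqVneq (v ord0 k) 0.
  apply/rowP => j; rewrite mxE; apply/eqP; rewrite -normr_le0.
  by rewrite (le_trans (kmax j isT))// vk normr0.
have M0 : 0 < M by rewrite normr_gt0.
exfalso.
have k0 : (0 < k)%N.
  by rewrite lt0n; apply: contraNneq vk => k0; rewrite -ordv k0 v0.
have kN : (k < N)%N.
  rewrite ltn_neqAle -ltnS ltn_ord andbT.
  by apply: contraNneq vk => kN; rewrite -ordv kN vN.
have kint : (0 < k < N)%N by rewrite k0.
have /Lv : (1 <= k <= N - 1)%N by rewrite k0 -ltnS subn1 prednK// (leq_trans _ kN).
have C0 : Calpha alpha != 0 by rewrite gt_eqF// Calpha_gt0 ?a0.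
rewrite /Lh => /eqP; rewrite mulf_eq0 (negbTE C0)/=.
have := SL_bound kint vM; have := SR_bound kint vM.
set TL := \sum_(s < Ne) theta s * SL _ _ _ _.
set TR := \sum_(s < Ne) theta s * SR _ _ _ _.
have hA : 0 < step x k `^ (- alpha) by rewrite powR_gt0 ?(step_gt0 hx)// k0 ltnW.
have hB : 0 < step x k.+1 `^ (- alpha) by rewrite powR_gt0 ?(step_gt0 hx).
set A := step x k `^ _ in hA *; set B := step x k.+1 `^ _ in hB *.
have /andP[akp _] := grid_bounds hx (leq_trans (leq_pred k) (ltnW kN)).
have /andP[_ kbp] := grid_bounds hx kN.
have hk : 0 < ent x k - ent x k.-1 by apply: (step_gt0 hx); rewrite k0 ltnW.
have hk1 : 0 < ent x k.+1 - ent x k by exact: (step_gt0 hx (j := k.+1)).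
have far (d : R) : 0 < d <= b - a -> (b - a) `^ (- alpha) <= d `^ (- alpha).
  move=> /andP[d0 dba]; have ba0 := lt_le_trans d0 dba.
  rewrite !powRN lef_pV2 ?posrE ?powR_gt0//.
  by rewrite ge0_ler_powR ?nnegrE ?(ltW a0) ?(ltW d0) ?(ltW ba0).
have /far fL : 0 < ent x k - a <= b - a by apply/andP; split; lra.
have /far fR : 0 < b - ent x k <= b - a by apply/andP; split; lra.
have ba0 : 0 < b - a by lra.
have epsba : eps * (b - a) <= (b - a) `^ (- alpha) / alpha.
  apply: (@le_trans _ _ ((b - a) `^ (- 1 - alpha) / alpha * (b - a))).
    by rewrite ler_wpM2r// ltW.
  rewrite mulrAC ler_wpM2r ?invr_ge0 ?(ltW a0)//.
  rewrite -[X in _ * X]powRr1 ?(ltW ba0)// -powRD; last by rewrite (gt_eqF ba0) implybT.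
  by rewrite (_ : - 1 - alpha + 1 = - alpha)//; ring.
have D0 : 0 < (b - a) `^ (- alpha) by rewrite powR_gt0.
have vp := vM _ (leq_trans (leq_pred k) (ltnW kN)).
have vq := vM _ kN.
rewrite (ordv k).
(* [D] is the power of the full length; [DL], [DR] are what remains of the
   left and right history budgets, up to the factor [1 / alpha]. *)
move: fL fR epsba D0; set D := (b - a) `^ _.
set DL := (ent x k - a) `^ _; set DR := (b - ent x k) `^ _.
move=> fL fR epsba D0 bR bL.
rewrite -addrA -opprD subr_eq0 => /eqP E.
have a1p : 0 < 1 - alpha by rewrite subr_gt0.
have a1n : 1 - alpha != 0 by rewrite gt_eqF.
have E' : (A + B) / (alpha * (1 - alpha)) * v ord0 k =
    (A * ent v k.-1 + B * ent v k.+1) / (1 - alpha) + TL + TR.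
  by rewrite -addrA -E; field; rewrite a1n gt_eqF.
have nE : (A + B) / (alpha * (1 - alpha)) * M <=
    (A + B) / (1 - alpha) * M + `|TL| + `|TR|.
  have -> : (A + B) / (alpha * (1 - alpha)) * M =
      `|(A + B) / (alpha * (1 - alpha)) * v ord0 k|.
    rewrite normrM gtr0_norm//.
    by rewrite divr_gt0 ?mulr_gt0// addr_gt0.
  rewrite E'; apply: le_trans (ler_normD _ _) _; rewrite lerD2r.
  apply: le_trans (ler_normD _ _) _; rewrite lerD2r normrM.
  rewrite [`|(_)^-1|]ger0_norm ?invr_ge0 ?(ltW a1p)// mulrAC.
  rewrite ler_wpM2r ?invr_ge0 ?(ltW a1p)//.
  apply: le_trans (ler_normD _ _) _; rewrite !normrM !(gtr0_norm hA, gtr0_norm hB).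
  by rewrite mulrDl lerD// ler_wpM2l ?(ltW hA) ?(ltW hB).
have split_diag : (A + B) / (alpha * (1 - alpha)) =
    (A + B) / (1 - alpha) + (A + B) / alpha.
  by field; rewrite a1n gt_eqF.
(* The budgets with [1 / (1 - alpha)], and then [A / alpha] and [B / alpha],
   cancel exactly. *)
have key : M * ((DL + DR) / alpha) <= M * (eps * (ent x k.-1 - a + (b - ent x k.+1))).
  move: nE bL bR; rewrite split_diag.
  rewrite (_ : (A - DL) / alpha = A / alpha - DL / alpha); last by rewrite mulrBl.
  rewrite (_ : (B - DR) / alpha = B / alpha - DR / alpha); last by rewrite mulrBl.
  rewrite !mulrDl; lra.
rewrite ler_pM2l// in key.
have : (DL + DR) / alpha <= D / alpha.
  apply: le_trans key (le_trans _ epsba); rewrite ler_wpM2l//; lra.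
by rewrite ler_pM2r ?invr_gt0//; lra.
Qed.

End history.

(** * Unique solvability *)

Lemma linear_injective_solvable (F : fieldType) (n : nat)
    (T : 'rV[F]_n -> 'rV[F]_n) : linear T ->
  (forall v, T v = 0 -> v = 0) -> forall g, exists! u, T u = g.
Proof.
move=> linT injT g.
pose Tl : {linear 'rV[F]_n -> 'rV[F]_n} :=
  HB.pack T (GRing.isLinear.Build _ _ _ _ T linT).
have TE u : T u = u *m lin1_mx Tl by rewrite mul_rV_lin1.
have uT : lin1_mx Tl \in unitmx.
  by rewrite -row_free_unit; apply: inj_row_free => v; rewrite -TE; exact: injT.
exists (g *m invmx (lin1_mx Tl)); split; first by rewrite TE mulmxKV.
by move=> u <-; rewrite TE mulmxK.
Qed.

Theorem theorem2p2 (R : realType) (alpha : R) (halpha : 0 < alpha < 1)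
    (N : nat) (hN : (0 < N)%N) (a b : R) (x : 'rV[R]_N.+1)
    (hx : is_grid a b x) :
  exists eps0 : R, 0 < eps0 /\
    forall eps : R, 0 < eps <= eps0 ->
    forall Dx X : R, 0 < Dx ->
      (forall j : nat, (1 <= j <= N)%N -> Dx <= step x j) ->
      b - a <= X ->
    forall (Ne : nat) (lam theta : 'I_Ne -> R),
      is_SOE alpha eps Dx X lam theta ->
    forall f : nat -> R,
      exists! U : 'rV[R]_N.+1,
        [/\ ent U 0 = 0, ent U N = 0 &
            forall i : nat, (1 <= i <= N - 1)%N -> Lh alpha x lam theta U i = f i].
Proof.
have /andP[a0 a1] := halpha.
have ba0 : 0 < b - a.
  have [<- <- xlt] := hx; rewrite subr_gt0 (lt_le_trans (xlt 0 hN))//.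
  by rewrite (grid_le hx)// hN leqnn.
exists ((b - a) `^ (- 1 - alpha) / alpha); split.
  by rewrite divr_gt0// powR_gt0.
move=> eps /andP[eps0 epsle] Dx X Dx0 DxE bX Ne lam theta soe f.
(* The square system: collocation equations at interior indices, and the
   identity at the two boundary indices. *)
pose bd (j : nat) := (j == 0)%N || (j == N).
pose T (v : 'rV[R]_N.+1) : 'rV[R]_N.+1 :=
  \row_(j < N.+1) (if bd j then v ord0 j else Lh alpha x lam theta v j).
pose g (h : nat -> R) : 'rV[R]_N.+1 := \row_(j < N.+1) (if bd j then 0 else h j).
have TgP (h : nat -> R) (U : 'rV[R]_N.+1) : T U = g h <->
    [/\ ent U 0 = 0, ent U N = 0 &
        forall i : nat, (1 <= i <= N - 1)%N -> Lh alpha x lam theta U i = h i].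
  have inner i : (1 <= i <= N - 1)%N = (i <= N)%N && ~~ bd i.
    rewrite /bd; case: i => [|i]; first by rewrite andbF.
    by rewrite /= subn1 -ltnS prednK// ltn_neqAle andbC.
  split=> [/rowP TU|[U0 UN UL]].
    have Tj j (jN : (j <= N)%N) : (if bd j then ent U j else Lh alpha x lam theta U j)
        = if bd j then 0 else h j.
      by have := TU (inord j); rewrite !mxE inordK ?ltnS.
    split.
    - exact: (Tj 0).
    - by have := Tj N (leqnn N); rewrite /bd eqxx orbT.
    - by move=> i; rewrite inner => /andP[/Tj + /negbTE bi]; rewrite bi.
  apply/rowP => j; rewrite !mxE; case: ifPn => [|bj].
    rewrite -[j in U ord0 j]inord_val -/(ent U j).
    by case/orP => /eqP ->.
  by apply: UL; rewrite inner bj -ltnS ltn_ord.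
have linT : linear T.
  move=> k u w; apply/rowP => j; rewrite !mxE.
  by case: ifP => // _; rewrite (Lh_linear hx).
have injT v : T v = 0 -> v = 0.
  move=> Tv; have /TgP[v0 vN Lv] : T v = g (fun=> 0).
    by rewrite Tv; apply/rowP => j; rewrite !mxE if_same.
  exact: (Lh_injective hx a0 Dx0 DxE bX soe a1 (ltW eps0) epsle v0 vN Lv).
have [U [/TgP UP Uuniq]] := linear_injective_solvable linT injT (g f).
by exists U; split=> // V /TgP /Uuniq.
Qed.
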